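(* Let $(\mathbb S,d)$ be a complete separable metric space and $X_n$, $n\ge1$, random elements of $\mathbb S$. Consider a family of measures $\{\mu^{(i)}\}_{i=0,1,\dots,m}$ and a family of closed subsets $\{\mathbb C(i)\}_{i=0,1,\dots,m}$ of $\mathbb S$ such that $\frac{1}{\epsilon_n(i)}\mathbf P(X_n\in\cdot)\to\mu^{(i)}(\cdot)$ in $\mathbb M(\mathbb S\setminus\mathbb C(i))$ for $i=0,\dots,m$, where $\{\epsilon_n(i):n\ge1\}$, $i=0,1,\dots,m$, are the associated normalizing sequences of positive real numbers. Suppose that $\mu^{(0)}\in\mathbb M\big(\mathbb S\setminus\bigcap_{i=0}^m\mathbb C(i)\big)$; that $\limsup_{n\to\infty}\frac{\epsilon_n(i)}{\epsilon_n(0)}=0$ for $i=1,\dots,m$; and that for each $r>0$ there exist positive numbers $r_0,\dots,r_m$ such that $\bigcap_{i=0}^m\mathbb C(i)^{r_i}\subseteq\big(\bigcap_{i=0}^m\mathbb C(i)\big)^r$. Then $$\frac{1}{\epsilon_n(0)}\mathbf P(X_n\in\cdot)\to\mu^{(0)}$$ in $\mathbb M\big(\mathbb S\setminus\bigcap_{i=0}^m\mathbb C(i)\big)$.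
   Context: For a closed subset $\mathbb C\subseteq\mathbb S$, put $\mathbb C^r=\{x\in\mathbb S:d(x,\mathbb C)<r\}$ for $r>0$ (empty if $\mathbb C=\emptyset$). $\mathbb M(\mathbb S\setminus\mathbb C)$ is the class of Borel measures on $\mathbb S\setminus\mathbb C$ whose restrictions to $\mathbb S\setminus\mathbb C^r$ are finite for all $r>0$; $\mu_n\to\mu$ in $\mathbb M(\mathbb S\setminus\mathbb C)$ means $\int f\,d\mu_n\to\int f\,d\mu$ for each non-negative bounded continuous $f$ vanishing on $\mathbb C^r$ for some $r>0$. Laws on $\mathbb S$ are restricted to $\mathbb S\setminus\mathbb C$. The measure $\mu^{(0)}$, given on $\mathbb S\setminus\mathbb C(0)$, is regarded as a measure on $\mathbb S\setminus\bigcap_{i=0}^m\mathbb C(i)$ that assigns zero mass to $\mathbb C(0)\setminus\bigcap_{i=0}^m\mathbb C(i)$. *)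

(* Defs.v *)
From HB Require Import structures.
From mathcomp Require Import all_boot all_order all_algebra.
From mathcomp Require Import all_classical all_reals all_analysis.

Set Implicit Arguments.
Unset Strict Implicit.
Unset Printing Implicit Defensive.

Import Order.TTheory GRing.Theory Num.Theory.
Import numFieldNormedType.Exports.

Local Open Scope classical_set_scope.
Local Open Scope ring_scope.

#[short(type="completeMetricType")]
HB.structure Definition CompleteMetric (R : numDomainType) :=
  { T of Complete T & Metric R T }.

Definition separable (T : topologicalType) : Prop :=
  exists2 A : set T, countable A & dense A.

Lemma closed_bigcapT (T : topologicalType) (I : choiceType) (C : I -> set T) :
  (forall i, closed (C i)) -> closed (\bigcap_i C i).
Proof. by move=> cC; apply: closed_bigI => i _; exact: cC. Qed.

Notation borel T := (g_sigma_algebraType (@open T)).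

Section neighborhood.
Context {R : realType} {S : metricType R}.
Implicit Types (C : set S) (x y : S) (r : R).

Definition thickening C r : set S := [set x | (edist_inf C x < r%:E)%E].

(* The library's [edist] is defined from balls; on a metric space it is the
   distance, so [thickening C r] is {x | d(x, C) < r} with inf over the empty
   set equal to +oo. *)
Lemma edist_mdist x y : edist (x, y) = (mdist x y)%:E.
Proof.
apply/eqP; rewrite eq_le; apply/andP; split.
  apply/lee_addgt0Pr => e e0; rewrite -EFinD; apply: edist_fin => /=.
    by rewrite ltr_wpDl// mdist_ge0.
  by rewrite ballEmdist/= ltrDl.
apply: le_ereal_inf_tmp => _ [r [r0 xyr] <-]; rewrite lee_fin.
by move: xyr; rewrite /= ballEmdist => /ltW.
Qed.

Lemma thickeningE C r :
  thickening C r = [set x | (ereal_inf [set (mdist x y)%:E | y in C] < r%:E)%E].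
Proof.
rewrite /thickening /edist_inf; congr [set x | _].
apply/funext => x; congr ((ereal_inf _ < _)%E : Prop).
by apply: eq_imagel => y _; exact: edist_mdist.
Qed.

Lemma thickening0 r : thickening set0 r = set0.
Proof.
by apply/seteqP; split => // x; rewrite /thickening/= /edist_inf image_set0 ereal_inf0.
Qed.

End neighborhood.

Section Mclass.
Context {R : realType} {S : completeMetricType R}.
Implicit Types C : set S.

Lemma closed_setC_borel C : closed C -> measurable (~` C : set (borel S)).
Proof. by move=> cC; apply: sub_sigma_algebra; exact: closed_openC. Qed.

(* A Borel measure on S \ C is represented by its extension by zero to S:
   a Borel measure on S that gives no mass to C. Under this encoding, a measure
   given on S \ C and regarded as a measure on the larger set S \ C', with
   C' a subset of C, assigning zero mass to C \ C', is the same measure on S. *)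
Definition in_M C (mu : {measure set (borel S) -> \bar R}) : Prop :=
  mu C = 0%E /\ forall r : R, 0 < r -> (mu (~` thickening C r) < +oo)%E.

(* Only the values of f on S \ C are constrained: f stands for a function
   defined on S \ C. *)
Definition test_function C (f : S -> R) : Prop :=
  [/\ forall x, (~` C) x -> 0 <= f x,
      exists M : R, forall x, (~` C) x -> f x <= M,
      {within ~` C, continuous f}
    & exists2 r : R, 0 < r &
        forall x, (~` C) x -> thickening C r x -> f x = 0].

Definition cvg_M C (mu_ : nat -> {measure set (borel S) -> \bar R})
    (mu : {measure set (borel S) -> \bar R}) : Prop :=
  [/\ forall n, in_M C (mu_ n),
      in_M C mu
    & forall f : S -> R, test_function C f ->
        (\int[mu_ n]_(x in ~` C) (f x)%:E)%E @[n --> \oo] -->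
        (\int[mu]_(x in ~` C) (f x)%:E)%E].

Definition scaled_law {d : measure_display} {Omega : measurableType d}
    (P : probability Omega R) (X : {RV P >-> borel S}) (e : {posnum R})
    C (cC : closed C) : {measure set (borel S) -> \bar R} :=
  mscale (e%:num^-1)%:nng (mrestr (distribution P X) (closed_setC_borel cC)).

End Mclass.

(* Main.v *)
Require Import Defs.
From HB Require Import structures.
From mathcomp Require Import all_boot all_order all_algebra.
From mathcomp Require Import all_classical all_reals all_analysis.
From mathcomp Require Import measurable_realfun lra.

Set Implicit Arguments.
Unset Strict Implicit.
Unset Printing Implicit Defensive.

Import Order.TTheory GRing.Theory Num.Theory.
Import numFieldNormedType.Exports.

Local Open Scope classical_set_scope.
Local Open Scope ring_scope.

(** Let D be the intersection of the C(i), let P_n be the law of X_n, and let f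
    be a test function for D, bounded by M and zero on the r-thickening of D.
    Pick radii r_i such that the intersection of the thickenings C(i)^(r_i) lies
    in D^r.

    For 0 < delta <= r_0 let phi be a continuous cutoff with values in [0, 1]
    which vanishes near C(0) and equals 1 off C(0)^delta, and for i > 0 let
    psi_i be the cutoff of the same kind for C(i) at radius r_i. Off D,

      f * phi  <=  f  <=  f * phi + M * (psi_1 + ... + psi_m).

    The upper bound holds because a point at which f is nonzero lies outside
    some C(i)^(r_i): if i = 0 then phi = 1 there, otherwise psi_i = 1
    ([test_function_cutoff_bound]).

    Integrate against P_n / eps_n(0). Since f * phi is a test function for C(0),
    its integral converges to that of f * phi against mu(0). Since psi_i is a
    test function for C(i), its integral against P_n / eps_n(i) converges to a
    finite limit, so against P_n / eps_n(0) it is smaller by a factor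
    eps_n(i) / eps_n(0) and vanishes ([negligible_scaled_integral]). Squeezing,
    the integral of f against P_n / eps_n(0) converges to the integral of
    f * phi against mu(0), for every such delta ([cvg_scaled_law_cutoff]).

    By uniqueness of limits the latter does not depend on delta. As delta
    decreases to 0, monotone convergence turns it into the integral of f off
    C(0) ([cvg_integral_cutoff]), which is the integral of f off D because mu(0)
    gives no mass to C(0). *)

(** * Cutoff functions of a closed set *)

Section cutoff.
Context {R : realType} {S : metricType R}.
Implicit Types (C : set S) (x : S) (r : R).

(** Truncating at [r] keeps the value finite even when [C] is empty, where
    [edist_inf C] is infinite. *)
Definition truncated_dist C r x : R := fine (mine (edist_inf C x) r%:E).

(** The Lipschitz function which is 0 up to distance r/2 from [C], 1 from
    distance r on, and affine in the distance in between. *)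
Definition cutoff C r x : R := Num.max 0 (2 * (truncated_dist C r x / r) - 1).

Lemma edist_inf_fin_num C x : C !=set0 -> edist_inf C x \is a fin_num.
Proof.
move=> [a Ca]; rewrite ge0_fin_numE ?edist_inf_ge0//.
apply: (@le_lt_trans _ _ (edist (x, a))); first by apply: ereal_inf_lbound; exists a.
by rewrite edist_mdist ltry.
Qed.

Lemma truncated_dist_continuous C r : continuous (truncated_dist C r).
Proof.
have [->|/set0P C0] := eqVneq C set0.
  have -> : truncated_dist set0 r = cst r.
    apply/funext => x; rewrite /truncated_dist /edist_inf image_set0 ereal_inf0.
    by rewrite min_r ?leey.
  by move=> x; exact: cvg_cst.
have -> : truncated_dist C r = (fine \o edist_inf C) \min cst r.
  apply/funext => x; rewrite /truncated_dist /=.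
  rewrite -[edist_inf C x in LHS]fineK ?edist_inf_fin_num//.
  by rewrite -EFin_min.
move=> x; apply: continuous_min; last exact: cvg_cst.
apply: fine_cvg; rewrite fineK ?edist_inf_fin_num//.
exact: edist_inf_continuous.
Qed.

Lemma cutoff_continuous C r : continuous (cutoff C r).
Proof.
move=> x; have -> : cutoff C r =
    cst 0 \max (fun y => 2 * (truncated_dist C r y / r) - 1) by [].
apply: continuous_max; first exact: cvg_cst.
apply: cvgB; last exact: cvg_cst.
apply: cvgM; first exact: cvg_cst.
by apply: cvgM; [exact: truncated_dist_continuous|exact: cvg_cst].
Qed.

Lemma cutoff_ge0 C r x : 0 <= cutoff C r x.
Proof. by rewrite /cutoff le_max lexx. Qed.

Lemma truncated_dist_le C r x : 0 < r -> 0 <= truncated_dist C r x <= r.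
Proof.
move=> r0; rewrite /truncated_dist.
have h : (0 <= mine (edist_inf C x) r%:E <= r%:E)%E.
  by rewrite le_min edist_inf_ge0/= lee_fin (ltW r0)/= ge_min lexx orbT.
have /andP[h1 h2] := h; rewrite fine_ge0//= -lee_fin fineK//.
by rewrite ge0_fin_numE ?edist_inf_ge0// (le_lt_trans h2)// ltry.
Qed.

Lemma cutoff_le1 C r x : 0 < r -> cutoff C r x <= 1.
Proof.
move=> r0; rewrite /cutoff ge_max ler01/=.
have /andP[_ h] := truncated_dist_le C x r0.
have : truncated_dist C r x / r <= 1 by rewrite ler_pdivrMr// mul1r.
by lra.
Qed.

Lemma cutoff_near C r x : 0 < r -> thickening C (r / 2) x -> cutoff C r x = 0.
Proof.
move=> r0 Cx; apply/max_idPl; rewrite /truncated_dist.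
have Cx' : (edist_inf C x < (r / 2)%:E)%E by [].
have fx : edist_inf C x \is a fin_num.
  by rewrite ge0_fin_numE ?edist_inf_ge0// (lt_trans Cx')// ltry.
have xr : (edist_inf C x <= r%:E)%E.
  by rewrite (le_trans (ltW Cx'))// lee_fin; lra.
rewrite min_l//; move: Cx'; rewrite -[X in (X < _)%E]fineK// lte_fin => Cx'.
have : fine (edist_inf C x) / r <= 2^-1.
  by rewrite ler_pdivrMr// mulrC ltW.
by lra.
Qed.

Lemma cutoff_far C r x : 0 < r -> ~ thickening C r x -> cutoff C r x = 1.
Proof.
move=> r0 /negP; rewrite -leNgt => Cx.
rewrite /cutoff /truncated_dist min_r//= divff ?gt_eqF// mulr1.
by rewrite max_r; lra.
Qed.

(** Because d(x, C) / r decreases in r and min(d, r) / r = min(d / r, 1). This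
    makes monotone convergence available when the radius shrinks. *)
Lemma cutoff_anti C r s x : 0 < r -> r <= s -> cutoff C s x <= cutoff C r x.
Proof.
move=> r0 rs; have s0 := lt_le_trans r0 rs.
suff : truncated_dist C s x / s <= truncated_dist C r x / r.
  move=> h; rewrite /cutoff ge_max le_max lexx/= le_max; apply/orP; right; lra.
rewrite /truncated_dist; have [xr|xr] := leP (edist_inf C x) r%:E.
  have fx : edist_inf C x \is a fin_num.
    by rewrite ge0_fin_numE ?edist_inf_ge0// (le_lt_trans xr)// ltry.
  rewrite min_l ?(le_trans xr)//.
  by rewrite ler_wpM2l ?fine_ge0 ?edist_inf_ge0// lef_pV2.
rewrite [leRHS]divff ?gt_eqF//.
by rewrite ler_pdivrMr// mul1r; have /andP[] := truncated_dist_le C x s0.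
Qed.

Lemma sub_thickening C r : 0 < r -> C `<=` thickening C r.
Proof. by move=> r0 x Cx; rewrite /thickening/= edist_inf0. Qed.

Lemma thickening_subset C r s : r <= s -> thickening C r `<=` thickening C s.
Proof. by move=> rs x Cx; apply: (lt_le_trans Cx); rewrite lee_fin. Qed.

Lemma notin_thickening C x : closed C -> ~ C x ->
  exists2 r : R, 0 < r & ~ thickening C r x.
Proof.
move=> cC Cx; have /nbhs_ballP[r /= r0 xr] : nbhs x (~` C).
  by apply: open_nbhs_nbhs; split => //; exact: closed_openC.
exists r => //; rewrite /thickening/=; apply/negP; rewrite -leNgt.
apply: le_ereal_inf_tmp => _ [a Ca <-]; rewrite leNgt; apply/negP.
by move=> /edist_lt_ball /xr.
Qed.

Lemma thickening_open C r : open (thickening C r).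
Proof.
have -> : thickening C r = edist_inf C @^-1` [set y | (y < r%:E)%E] by [].
apply: open_comp; last exact: open_ereal_lt_ereal.
by move=> x _; exact: edist_inf_continuous.
Qed.

End cutoff.

(** * Test functions *)

Section test.
Context {R : realType} {S : completeMetricType R}.
Implicit Types (C D : set S) (f : S -> R) (r : R).

Lemma closed_borel C : closed C -> measurable (C : set (borel S)).
Proof. by move=> /closed_setC_borel /measurableC; rewrite setCK. Qed.

Lemma continuous_borel_measurable (A : set S) f : open A ->
  {within A, continuous f} -> measurable_fun (A : set (borel S)) f.
Proof.
move=> oA /continuousP cf.
apply: (measurability _ (RGenOpens.measurableE R)).
move=> _ [_ [a [b ->] <-]]; apply: sub_sigma_algebra.
have /(cf _) : open `]a, b[%classic by exact: interval_open.
by rewrite -(open_setIS _ oA) setIC.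
Qed.

Lemma test_function_measurable C f : closed C -> test_function C f ->
  measurable_fun (~` C : set (borel S)) (EFin \o f).
Proof.
move=> cC [_ _ cf _]; apply/measurable_EFinP.
by apply: continuous_borel_measurable => //; exact: closed_openC.
Qed.

Lemma cutoff_measurable C r (A : set (borel S)) :
  measurable_fun A (EFin \o cutoff C r).
Proof.
apply/measurable_EFinP; apply: (@measurable_funS _ _ _ _ setT) => //.
apply: continuous_borel_measurable; first exact: openT.
by apply: continuous_subspaceT; exact: cutoff_continuous.
Qed.

Lemma test_function_cutoff C r : 0 < r -> test_function C (cutoff C r).
Proof.
move=> r0; split.
- by move=> x _; exact: cutoff_ge0.
- by exists 1 => x _; exact: cutoff_le1.
- by apply: continuous_subspaceT; exact: cutoff_continuous.
- by exists (r / 2); [rewrite divr_gt0|move=> x _; exact: cutoff_near].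
Qed.

(** Localization: the cutoff restores the vanishing near [C] that [f], which
    vanishes only near the smaller set [D], may lack. *)
Lemma test_function_mul_cutoff C D f r : D `<=` C -> 0 < r ->
  test_function D f -> test_function C (fun x => f x * cutoff C r x).
Proof.
move=> DC r0 [f0 [M fM] cf _]; have CD := subsetC DC; split.
- by move=> x /CD Dx; rewrite mulr_ge0 ?f0 ?cutoff_ge0.
- exists M => x /CD Dx; apply: le_trans (fM _ Dx).
  by rewrite ler_piMr ?f0 ?cutoff_le1.
- have cf' := continuous_subspaceW CD cf.
  have cg : {within ~` C, continuous (cutoff C r)}.
    by apply: continuous_subspaceT; exact: cutoff_continuous.
  by move=> x; apply: cvgM; [exact: cf'|exact: cg].
- exists (r / 2); first by rewrite divr_gt0.
  by move=> x _ Cx; rewrite cutoff_near ?mulr0.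
Qed.

(** On [~` C] the integrand is at most M times the indicator of the complement
    of a thickening of [C], a set of finite mass. *)
Lemma test_function_integral_lty C f (mu : {measure set (borel S) -> \bar R}) :
  closed C -> in_M C mu -> test_function C f ->
  (\int[mu]_(x in ~` C) (f x)%:E < +oo)%E.
Proof.
move=> cC [_ muC] tf; have mf := test_function_measurable cC tf.
have [f0 [M fM] _ [r r0 fr]] := tf.
have mC := closed_setC_borel cC.
have mT : measurable (~` thickening C r : set (borel S)).
  by apply: measurableC; apply: sub_sigma_algebra; exact: thickening_open.
apply: (@le_lt_trans _ _
  (\int[mu]_(x in ~` C) (`|M|%:E * (\1_(~` thickening C r) x)%:E))%E).
  apply: ge0_le_integral => //.
  - apply: measurable_funeM; apply/measurable_EFinP.
    exact: measurable_indic.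
  - move=> x Cx; rewrite -EFinM lee_fin indicE.
    have [xr|xr] := boolP (x \in _).
      by rewrite mulr1 (le_trans (fM _ Cx)) ?ler_norm.
    rewrite mulr0 fr//; apply: contrapT.
    by move/negP: xr => /[swap] xr; apply; rewrite inE.
rewrite ge0_integralZl//=; last first.
  by apply/measurable_EFinP; exact: measurable_indic.
rewrite integral_indic// lte_mul_pinfty//.
apply: le_lt_trans (muC _ r0); apply: le_measure; rewrite ?inE//.
exact: measurableI.
Qed.

End test.

(** * Integration against scaled laws *)

Section integration.
Local Open Scope ereal_scope.

Lemma integral_null_outside d (T : measurableType d) (R : realType)
    (mu : {measure set T -> \bar R}) (A B : set T) (f : T -> \bar R) :
  A `<=` B -> (forall x, B x -> ~ A x -> f x = 0) ->
  \int[mu]_(x in B) f x = \int[mu]_(x in A) f x.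
Proof.
move=> AB f0; rewrite integral_mkcond [RHS]integral_mkcond; congr (integral _ _ _).
apply/funext => x; rewrite /patch.
have [/set_mem Ax|/negP Ax] := boolP (x \in A).
  by rewrite mem_set//; exact: AB.
have [/set_mem Bx|//] := boolP (x \in B).
by apply: f0 => // Ax'; apply: Ax; rewrite inE.
Qed.

(** The normalization factors out and the restriction to [~` C] disappears: laws
    restricted off different sets become integrals against one common law. *)
Lemma integral_scaled_law {R : realType} {S : completeMetricType R}
    {d : measure_display} {Omega : measurableType d}
    (P : probability Omega R) (X : {RV P >-> borel S}) (e : {posnum R})
    (C : set S) (cC : closed C) (f : S -> \bar R) :
  measurable_fun (~` C : set (borel S)) f -> (forall x, (~` C) x -> 0 <= f x) ->
  \int[scaled_law X e cC]_(x in ~` C) f x =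
  (e%:num^-1)%:E * \int[distribution P X]_(x in ~` C) f x.
Proof.
move=> mf f0; have mC := closed_setC_borel cC.
rewrite ge0_integral_mscale//=; congr (_ * _).
by apply: eq_measure_integral => A mA AC; rewrite /=/mrestr setIidl.
Qed.

End integration.

Section laws.
Context {R : realType} {S : completeMetricType R}
  {d : measure_display} {Omega : measurableType d} {P : probability Omega R}.
Implicit Types (C D : set S) (X : {RV P >-> borel S}) (e : {posnum R}).
Local Open Scope ereal_scope.

Lemma scaled_law_in_M X e C (cC : closed C) : in_M C (scaled_law X e cC).
Proof.
split; first by rewrite /= /mscale/= /mrestr setICr measure0 mule0.
move=> r _; rewrite /= /mscale/= /mrestr lte_mul_pinfty//.
rewrite (le_lt_trans (probability_le1 _ _)) ?ltry//.
apply: measurableI; last exact: closed_setC_borel.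
by apply: measurableC; apply: sub_sigma_algebra; exact: thickening_open.
Qed.

(** The integral normalized by [e n] converges to a finite limit; changing the
    normalization to [e0 n] multiplies it by the ratio, which tends to 0. *)
Lemma negligible_scaled_integral (X : nat -> {RV P >-> borel S})
    (e e0 : nat -> {posnum R}) C (cC : closed C)
    (mu : {measure set (borel S) -> \bar R}) (f : S -> R) :
  cvg_M C (fun n => scaled_law (X n) (e n) cC) mu ->
  ((e n)%:num / (e0 n)%:num)%:E @[n --> \oo] --> 0 ->
  test_function C f ->
  ((e0 n)%:num^-1)%:E * \int[distribution P (X n)]_(x in ~` C) (f x)%:E
    @[n --> \oo] --> 0.
Proof.
move=> [_ muM cvgmu] ratio tf.
have mf := test_function_measurable cC tf; have [f0 _ _ _] := tf.
have int_fin : \int[mu]_(x in ~` C) (f x)%:E \is a fin_num.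
  rewrite ge0_fin_numE; first exact: test_function_integral_lty.
  by apply: integral_ge0 => x Cx; rewrite lee_fin f0.
rewrite -(mul0e (\int[mu]_(x in ~` C) (f x)%:E)).
have := cvgeM (mule_def_fin _ int_fin) ratio (cvgmu f tf).
move=> /(_ _ isT); apply: cvg_trans; apply: near_eq_cvg; apply: nearW => n /=.
rewrite integral_scaled_law//.
rewrite muleA -EFinM; congr (_%:E * _).
by rewrite mulrAC divff ?mul1r.
Qed.

(** As [C] is closed, every point of [~` C] is at positive distance from [C], so
    the cutoffs of radius [r / k.+1] increase to 1 there, and monotone
    convergence applies. *)
Lemma cvg_integral_cutoff (mu : {measure set (borel S) -> \bar R}) C
    (f : S -> R) (r : R) :
  closed C -> (0 < r)%R -> measurable_fun (~` C : set (borel S)) (EFin \o f) ->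
  (forall x, (~` C) x -> (0 <= f x)%R) ->
  \int[mu]_(x in ~` C) (f x * cutoff C (r / k.+1%:R) x)%:E @[k --> \oo] -->
  \int[mu]_(x in ~` C) (f x)%:E.
Proof.
move=> cC r0 mf f0; have mC := closed_setC_borel cC.
pose g k x := (f x * cutoff C (r / k.+1%:R) x)%:E.
have rk k : (0 < r / k.+1%:R :> R)%R by rewrite divr_gt0.
have limg x : (~` C) x -> g ^~ x @ \oo --> (f x)%:E.
  move=> Cx; apply: cvg_near_cst.
  have [s s0 xs] := notin_thickening cC Cx.
  have [N rN] : exists N, (r / s < N.+1%:R)%R.
    by exists (Num.truncn (r / s)); exact: truncnS_gt.
  exists N => // k /= Nk; rewrite /g cutoff_far ?mulr1//.
  move=> /(@thickening_subset _ _ _ _ s) xk; apply/xs/xk.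
  rewrite ler_pdivrMr// mulrC -ler_pdivrMr// (le_trans (ltW rN))//.
  by rewrite ler_nat.
rewrite (_ : \int[mu]_(x in ~` C) (f x)%:E =
             \int[mu]_(x in ~` C) limn (g ^~ x)); last first.
  by apply: eq_integral => x /set_mem Cx; apply/esym/cvg_lim => //; exact: limg.
apply: cvg_monotone_convergence => //.
- move=> k; rewrite /g.
  under eq_fun do rewrite EFinM.
  by apply: emeasurable_funM => //; exact: cutoff_measurable.
- by move=> k x Cx; rewrite lee_fin mulr_ge0 ?f0 ?cutoff_ge0.
- move=> x Cx k l kl; rewrite lee_fin ler_wpM2l ?f0// cutoff_anti//.
  by rewrite ler_wpM2l ?(ltW r0)// lef_pV2 ?posrE// ler_nat.
Qed.


(** * Truncation near the first closed set *)

Section truncation.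
Variables (m : nat) (C : 'I_m.+1 -> set S).
Hypothesis closedC : forall i, closed (C i).
Variables (X : nat -> {RV P >-> borel S}) (eps : 'I_m.+1 -> nat -> {posnum R}).
Variable mu : 'I_m.+1 -> {measure set (borel S) -> \bar R}.
Hypothesis cvg_mu : forall i,
  cvg_M (C i) (fun n => scaled_law (X n) (eps i n) (@closedC i)) (mu i).
Hypothesis eps_small : forall i, i != ord0 ->
  ((eps i n)%:num / (eps ord0 n)%:num)%:E @[n --> \oo] --> 0.

Let D := \bigcap_i C i.

Let DC i : D `<=` C i. Proof. by move=> x; apply. Qed.

(** The error made by the cutoff at [C ord0] is charged to the other sets: where
    [f x] is nonzero, [x] lies off [thickening (C i) (r_ i)] for some [i], and
    either the first cutoff is 1 or the [i]-th term of the sum is at least [M].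
    The indices other than [ord0] are enumerated by [lift ord0]. *)
Lemma test_function_cutoff_bound (f : S -> R) (M : R) (r_ : 'I_m.+1 -> R)
    (r delta : R) x :
  (forall i, 0 < r_ i)%R -> \bigcap_i thickening (C i) (r_ i) `<=` thickening D r ->
  (0 <= f x <= M)%R -> (thickening D r x -> f x = 0%R) ->
  (0 < delta <= r_ ord0)%R ->
  (f x <= f x * cutoff (C ord0) delta x +
          \sum_(j < m) M * cutoff (C (lift ord0 j)) (r_ (lift ord0 j)) x)%R.
Proof.
move=> r0 rD /andP[f0 fM] fr /andP[delta0 deltar].
have M0 := le_trans f0 fM.
have term_ge0 j : (0 <= M * cutoff (C (lift ord0 j)) (r_ (lift ord0 j)) x)%R.
  by rewrite mulr_ge0 ?cutoff_ge0.
have [xr|] := pselect ((\bigcap_i thickening (C i) (r_ i)) x).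
  by rewrite fr; [rewrite mul0r add0r sumr_ge0|exact: rD].
move=> /existsNP[i /not_implyP[_]].
case: (unliftP ord0 i) => [j|] ->{i} xi.
  rewrite ler_wpDl ?mulr_ge0 ?cutoff_ge0//.
  rewrite (bigD1 j)//= cutoff_far// mulr1.
  by rewrite ler_wpDr// sumr_ge0.
rewrite cutoff_far//; last by move=> /(thickening_subset deltar).
by rewrite mulr1 lerDl sumr_ge0.
Qed.

(** The integrals of f * phi and of the upper bound given by
    [test_function_cutoff_bound] have the same limit. This limit shows [delta]
    but the convergent sequence does not, hence its value is independent of
    [delta]. *)
Lemma cvg_scaled_law_cutoff (closedD : closed D) (f : S -> R)
    (r_ : 'I_m.+1 -> R) (r delta : R) :
  (forall i, 0 < r_ i)%R -> \bigcap_i thickening (C i) (r_ i) `<=` thickening D r ->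
  test_function D f -> (forall x, (~` D) x -> thickening D r x -> f x = 0%R) ->
  (0 < delta <= r_ ord0)%R ->
  \int[scaled_law (X n) (eps ord0 n) closedD]_(x in ~` D) (f x)%:E
    @[n --> \oo] -->
  \int[mu ord0]_(x in ~` C ord0) (f x * cutoff (C ord0) delta x)%:E.
Proof.
move=> r0 rD tf fr delta_r; have /andP[delta0 _] := delta_r.
have mf := test_function_measurable closedD tf.
have [f0 [M fM] _ _] := tf.
have mD := closed_setC_borel closedD.
set fphi := fun x => (f x * cutoff (C ord0) delta x)%R.
have tfphi : test_function (C ord0) fphi by exact: test_function_mul_cutoff.
have mfphi : measurable_fun (~` D : set (borel S)) (EFin \o fphi).
  rewrite (_ : _ \o _ = fun x => (f x)%:E * (cutoff (C ord0) delta x)%:E)//.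
  by apply: emeasurable_funM => //; exact: cutoff_measurable.
have fphi0 x : (~` D) x -> (0 <= fphi x)%R.
  by move=> Dx; rewrite mulr_ge0 ?f0 ?cutoff_ge0.
pose psi (j : 'I_m) x := cutoff (C (lift ord0 j)) (r_ (lift ord0 j)) x.
(* [fphi] and [psi j] vanish on the respective closed sets, so integrating them
   over [~` D] or over the smaller complements gives the same value. *)
have fphi_cvg :
    ((eps ord0 n)%:num^-1)%:E * \int[distribution P (X n)]_(x in ~` D) (fphi x)%:E
    @[n --> \oo] --> \int[mu ord0]_(x in ~` C ord0) (fphi x)%:E.
  have [_ _ /(_ _ tfphi)] := cvg_mu ord0.
  apply: cvg_trans; apply: near_eq_cvg; apply: nearW => n /=.
  rewrite integral_scaled_law//; last 2 first.
  - exact: test_function_measurable.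
  - by move=> x Cx; rewrite lee_fin; have [+ _ _ _] := tfphi; apply.
  congr (_ * _); apply/esym/integral_null_outside; first exact: subsetC.
  move=> x _ /contrapT Cx; rewrite /fphi cutoff_near ?mulr0//.
  by apply: sub_thickening => //; rewrite divr_gt0.
have psi_cvg j :
    ((eps ord0 n)%:num^-1)%:E * \int[distribution P (X n)]_(x in ~` D) (psi j x)%:E
    @[n --> \oo] --> 0.
  have := negligible_scaled_integral (cvg_mu (lift ord0 j))
    (eps_small (isT : lift ord0 j != ord0))
    (test_function_cutoff _ (r0 (lift ord0 j))).
  apply: cvg_trans; apply: near_eq_cvg; apply: nearW => n /=.
  congr (_ * _); apply/esym/integral_null_outside; first exact: subsetC.
  move=> x _ /contrapT Cx; rewrite /psi cutoff_near//.
  by apply: sub_thickening => //; rewrite divr_gt0.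
(* [M] itself may be negative when [~` D] is empty, hence the absolute value. *)
have error_cvg : \sum_(j < m) `|M|%:E *
    (((eps ord0 n)%:num^-1)%:E *
     \int[distribution P (X n)]_(x in ~` D) (psi j x)%:E)
    @[n --> \oo] --> 0.
  rewrite -[X in _ --> X](@big1 _ 0 +%E _ (index_enum 'I_m) xpredT (fun=> 0))//.
  apply: cvg_nnesum => [j _|j _].
    apply: nearW => n; rewrite !mule_ge0//.
    by apply: integral_ge0 => x _; rewrite lee_fin cutoff_ge0.
  by rewrite -(mule0 `|M|%:E); exact: cvgeZl.
have upper_cvg := cvgeD
  (fin_num_adde_defl _ (isT : (0 : \bar R) \is a fin_num)) fphi_cvg error_cvg.
rewrite adde0 in upper_cvg.
have {}upper_cvg := upper_cvg (eventually_filter : Filter \oo).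
apply: squeeze_cvge; [|exact: fphi_cvg|exact: upper_cvg]; apply: nearW => n /=.
rewrite integral_scaled_law//.
apply/andP; split.
  apply: lee_wpmul2l => //; apply: ge0_le_integral => //.
  by move=> x Dx; rewrite lee_fin ler_piMr ?f0 ?cutoff_le1.
have mpsi j : measurable_fun (~` D : set (borel S)) (EFin \o psi j).
  exact: cutoff_measurable.
have psi0 j x : (~` D) x -> 0 <= (psi j x)%:E by rewrite lee_fin cutoff_ge0.
have -> : \sum_(j < m) `|M|%:E * (((eps ord0 n)%:num^-1)%:E *
      \int[distribution P (X n)]_(x in ~` D) (psi j x)%:E) =
    ((eps ord0 n)%:num^-1)%:E *
      \int[distribution P (X n)]_(x in ~` D) \sum_(j < m) `|M|%:E * (psi j x)%:E.
  rewrite ge0_integral_sum//; last 2 first.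
  - by move=> j; apply: measurable_funeM; exact: mpsi.
  - by move=> j x Dx; rewrite mule_ge0// psi0.
  rewrite ge0_sume_distrr => [|j _]; last first.
    by apply: integral_ge0 => x Dx; rewrite mule_ge0// psi0.
  apply: eq_bigr => j _; rewrite ge0_integralZl//; last 2 first.
  - exact: mpsi.
  - by move=> x; exact: psi0.
  by rewrite muleCA.
have sum0 x : (~` D) x -> 0 <= \sum_(j < m) `|M|%:E * (psi j x)%:E.
  by move=> Dx; apply: sume_ge0 => j _; rewrite mule_ge0// psi0.
have msum : measurable_fun (~` D : set (borel S))
    (fun x => \sum_(j < m) `|M|%:E * (psi j x)%:E).
  by apply: emeasurable_sum => j; apply: measurable_funeM; exact: mpsi.
rewrite -ge0_muleDr; last 2 first.
- by apply: integral_ge0 => x Dx; rewrite lee_fin fphi0.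
- exact: integral_ge0.
apply: lee_wpmul2l => //.
rewrite -ge0_integralD//.
apply: ge0_le_integral => //.
  by apply: emeasurable_funD.
move=> x Dx; rewrite /=.
under eq_bigr do rewrite -EFinM.
rewrite sumEFin -EFinD lee_fin.
apply: test_function_cutoff_bound r0 rD _ _ delta_r; last exact: fr.
by rewrite f0//= (le_trans (fM _ Dx)) ?ler_norm.
Qed.

End truncation.

End laws.


Theorem lemma2p3 (R : realType) (S : completeMetricType R)
    (sepS : separable S)
    (d : measure_display) (Omega : measurableType d) (P : probability Omega R)
    (X : nat -> {RV P >-> borel S})
    (m : nat)
    (mu : 'I_m.+1 -> {measure set (borel S) -> \bar R})
    (C : 'I_m.+1 -> set S) (closedC : forall i, closed (C i))
    (eps : 'I_m.+1 -> nat -> {posnum R})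
    (cvg_mu : forall i : 'I_m.+1,
        cvg_M (C i) (fun n => scaled_law (X n) (eps i n) (closedC i)) (mu i))
    (mu0_M : in_M (\bigcap_i C i) (mu ord0))
    (eps_small : forall i : 'I_m.+1, i != ord0 ->
        limn_esup (fun n => ((eps i n)%:num / (eps ord0 n)%:num)%:E) = 0%E)
    (C_thick : forall r : R, 0 < r ->
        exists2 r_ : 'I_m.+1 -> R, (forall i, 0 < r_ i) &
          \bigcap_i thickening (C i) (r_ i) `<=` thickening (\bigcap_i C i) r) :
  cvg_M (\bigcap_i C i)
    (fun n => scaled_law (X n) (eps ord0 n)
                (closed_bigcapT closedC))
    (mu ord0).
Proof.
split=> // [n|f tf]; first exact: scaled_law_in_M.
have cD := closed_bigcapT closedC.
have eps_cvg i : i != ord0 ->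
    ((eps i n)%:num / (eps ord0 n)%:num)%:E @[n --> \oo] --> 0%E.
  by move=> i0; apply: limn_esup_le_cvg; rewrite ?eps_small.
have mf := test_function_measurable cD tf.
have DC : \bigcap_i C i `<=` C ord0 by move=> x; apply.
have CD := subsetC DC.
have mC0 := closed_setC_borel (closedC ord0).
have mD := closed_setC_borel cD.
have [f0 _ _ [r r0 fr]] := tf.
have [r_ r_0 rD] := C_thick _ r0.
have delta_r k : 0 < r_ ord0 / k.+1%:R <= r_ ord0.
  rewrite divr_gt0//= ler_pdivrMr// ler_peMr ?ler1n//.
  exact: ltW.
have cvg_k k := cvg_scaled_law_cutoff cvg_mu eps_cvg (closed_bigcapT closedC)
  r_0 rD tf fr (delta_r k).
have mu0C : mu ord0 (C ord0) = 0%E by have [_ []] := cvg_mu ord0.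
have mf0 : measurable_fun (~` C ord0 : set (borel S)) (EFin \o f).
  exact: measurable_funS mf.
have int_f : (\int[mu ord0]_(x in ~` C ord0) (f x)%:E)%E =
    (\int[mu ord0]_(x in ~` \bigcap_i C i) (f x)%:E)%E.
  rewrite (ge0_negligible_integral (closed_borel (closedC ord0)) mD mf _ mu0C)//.
  by congr (integral _ _ _); rewrite setDE setIC (setIidl CD).
have f0' x : (~` C ord0) x -> 0 <= f x by move=> /CD; exact: f0.
have cvg_f := cvg_integral_cutoff (closedC ord0) (r_0 ord0) mf0 f0'.
(* The integrals are limits of one and the same sequence, whatever the radius. *)
have const k :
    (\int[mu ord0]_(x in ~` C ord0)
       (f x * cutoff (C ord0) (r_ ord0 / k.+1%:R) x)%:E)%E =
    (\int[mu ord0]_(x in ~` C ord0)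
       (f x * cutoff (C ord0) (r_ ord0 / 1) x)%:E)%E.
  exact: (cvg_unique (@ereal_hausdorff R) (cvg_k k) (cvg_k 0)).
have := cvg_f (mu ord0); under eq_fun do rewrite const.
move=> /(cvg_unique (@ereal_hausdorff R) (cvg_cst _)).
rewrite int_f => <-.
exact: (cvg_k 0).
Qed.
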